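(* Enforcing bound consistency on the \textsc{RegularGcc} matrix constraint is W[2]-hard with respect to the parameter $k=R$, the number of rows of the matrix, even when the variables take values from a set of just $2$ values.
   Context: An instance of \textsc{RegularGcc} consists of an $R\times C$ matrix of finite-domain decision variables in which each row must be accepted by a given deterministic finite automaton (\textsc{Regular} constraint) and each column is subject to a global cardinality constraint \textsc{Gcc}, prescribing for each value $v$ lower and/or upper bounds on the number of occurrences of $v$ in that column. Bound consistency (BC): domains are intervals of the value order and both endpoints of each domain extend to a solution; enforcing BC detects a wipe-out exactly when no solution exists. W[2]-hardness is with respect to parameterized (fpt) reductions; e.g. $p$-\textsc{Hitting-Set} (given a hypergraph and $k$, is there a set of $k$ vertices meeting every hyperedge, parameterized by $k$) is W[2]-complete. *)

(* Defs.v *)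
From mathcomp Require Import all_boot.
Set Implicit Arguments. Unset Strict Implicit. Unset Printing Implicit Defensive.

Inductive dir := DLeft | DRight | DStay.

Record TM := {
  tm_st : finType;
  tm_gam : finType;
  tm_blank : tm_gam;
  tm_in : bool -> tm_gam;
  tm_out : tm_gam -> option bool;
  tm_start : tm_st;
  tm_halt : tm_st;
  tm_delta : tm_st -> tm_gam -> tm_st * tm_gam * dir }.

(* configuration: state, cells left of head (nearest first),
   cells from head rightwards (missing cells are blank) *)
Record config (M : TM) := Config {
  cf_st : tm_st M; cf_left : seq (tm_gam M); cf_right : seq (tm_gam M) }.

Definition tm_step (M : TM) (c : config M) : config M :=
  if cf_st c == tm_halt M then c else
  let a := head (tm_blank M) (cf_right c) in
  let '(q', b, d) := @tm_delta M (cf_st c) a in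
  match d with
  | DStay => @Config M q' (cf_left c) (b :: behead (cf_right c))
  | DRight => @Config M q' (b :: cf_left c) (behead (cf_right c))
  | DLeft => match cf_left c with
             | [::] => @Config M q' [::] (b :: behead (cf_right c))
             | x :: l => @Config M q' l (x :: b :: behead (cf_right c))
             end
  end.

Definition tm_init (M : TM) (x : seq bool) : config M :=
  @Config M (tm_start M) [::] (map (tm_in M) x).

Fixpoint tm_read (M : TM) (s : seq (tm_gam M)) : seq bool :=
  match s with
  | a :: s' => match @tm_out M a with Some b => b :: @tm_read M s' | None => [::] end
  | [::] => [::]
  end.

Definition runs_in (M : TM) (x : seq bool) (t : nat) (y : seq bool) : Prop :=
  exists2 n, n <= t &
    let c := iter n (@tm_step M) (tm_init M x) in
    cf_st c = tm_halt M /\ @tm_read M (cf_right c) = y.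

Definition enc_nat (n : nat) : seq bool := rcons (nseq n true) false.
Definition enc_seq (T : Type) (f : T -> seq bool) (s : seq T) : seq bool :=
  enc_nat (size s) ++ flatten (map f s).

Definition fn_computable (f : nat -> nat) : Prop :=
  exists M : TM, forall n, exists t, runs_in M (enc_nat n) t (enc_nat (f n)).

Definition fpt_reduction (I J : Type)
    (A : I -> Prop) (ka : I -> nat) (encA : I -> seq bool)
    (B : J -> Prop) (kb : J -> nat) (encB : J -> seq bool) : Prop :=
  exists (M : TM) (f g : nat -> nat) (c : nat),
    fn_computable f /\ fn_computable g /\
    forall x : I, exists y : J,
      runs_in M (encA x) (f (ka x) * (size (encA x)).+1 ^ c) (encB y) /\
      (A x <-> B y) /\ kb y <= g (ka x).

Record HSInst := { hs_n : nat;                  (* vertices 0..hs_n-1 *)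
                   hs_edges : seq (seq nat);
                   hs_k : nat }.

Definition hs_yes (I : HSInst) : Prop :=
  exists S : seq nat,
    [/\ uniq S, size S = hs_k I, all (fun v => v < hs_n I) S &
        all (fun e => has (fun v => v \in S) e) (hs_edges I)].

Definition enc_hs (I : HSInst) : seq bool :=
  enc_nat (hs_n I) ++ enc_seq (enc_seq enc_nat) (hs_edges I) ++ enc_nat (hs_k I).

(* W[2]-hardness: p-Hitting-Set (W[2]-complete) fpt-reduces to it *)
Definition W2_hard (J : Type) (B : J -> Prop) (kb : J -> nat)
    (encB : J -> seq bool) : Prop :=
  fpt_reduction hs_yes hs_k enc_hs B kb encB.

(* DFA over alphabet bool; states are naturals; state s < size trans
   moves to (nth s trans).1 on false and .2 on true; other states are
   sinks. *)
Record DFA := { dfa_start : nat; dfa_trans : seq (nat * nat); dfa_acc : seq nat }.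

Definition dfa_next (A : DFA) (s : nat) (b : bool) : nat :=
  if s < size (dfa_trans A) then
    (if b then (nth (0, 0) (dfa_trans A) s).2 else (nth (0, 0) (dfa_trans A) s).1)
  else s.

Definition dfa_accepts (A : DFA) (w : seq bool) : bool :=
  foldl (dfa_next A) (dfa_start A) w \in dfa_acc A.

(* instance: R rows, one DFA for the rows, and for each of the C columns
   bounds (l0, u0, l1, u1): occurrences of value false in [l0,u0],
   of value true in [l1,u1] (an absent bound is expressed as 0 / R). *)
Record RGInst := { rg_R : nat; rg_dfa : DFA; rg_gcc : seq (nat * nat * nat * nat) }.

Definition rg_C (I : RGInst) : nat := size (rg_gcc I).

Definition rg_sol (I : RGInst) (X : seq (seq bool)) : Prop :=
  [/\ size X = rg_R I,
      all (fun row => size row == rg_C I) X,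
      all (dfa_accepts (rg_dfa I)) X &
      forall j, j < rg_C I ->
        let col := map (fun row => nth false row j) X in
        let '(l0, u0, l1, u1) := nth (0, 0, 0, 0) (rg_gcc I) j in
        (l0 <= count_mem false col <= u0) /\ (l1 <= count_mem true col <= u1)].

Definition rg_yes (I : RGInst) : Prop := exists X, rg_sol I X.

Definition enc_pair (p : nat * nat) : seq bool := enc_nat p.1 ++ enc_nat p.2.
Definition enc_quad (q : nat * nat * nat * nat) : seq bool :=
  let '(a, b, c, d) := q in enc_nat a ++ enc_nat b ++ enc_nat c ++ enc_nat d.
Definition enc_dfa (A : DFA) : seq bool :=
  enc_nat (dfa_start A) ++ enc_seq enc_pair (dfa_trans A) ++ enc_seq enc_nat (dfa_acc A).
Definition enc_rg (I : RGInst) : seq bool :=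
  enc_nat (rg_R I) ++ enc_dfa (rg_dfa I) ++ enc_seq enc_quad (rg_gcc I).

(* Main.v *)
(* From a hypergraph with n vertices and m edges and an integer k, build a
   matrix with k rows and n + m columns.  A row stands for one vertex v of the
   hitting set: its first n entries are the indicator of v, and it may hold a
   true entry in the column of an edge e only if v lies in e; a DFA whose state
   is the pair (current column, v) checks this.  Column bounds ask for at most
   one true entry in a vertex column, so that the k vertices are distinct, and
   for at least one in an edge column, so that every edge is hit.

   The reduction runs on a single-tape machine.  It is written in a language
   whose registers are bounded by the length of the input and whose only loops
   are [for x < y], so that every program takes polynomially many steps.  A
   program is compiled to a machine with one tape track per register, the value
   v of a register being v marks at the left end of its track; each elementary
   operation is one sweep over the tape, there and back. *)
Require Import Defs.
From mathcomp Require Import all_boot zify.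
Set Implicit Arguments. Unset Strict Implicit. Unset Printing Implicit Defensive.

(** * Loop programs *)

Section Language.

Variable X : finType.

Inductive op :=
  | Emit of bool | Zero of X | Fill of X | Copy of X & X | Incr of X
  | Lt of X & X | Inp of X.

Inductive cmd :=
  | Do of op | Seq of cmd & cmd | If of op & cmd & cmd | For of X & X & cmd.

Record state := State { reg : X -> nat; out : seq bool }.

Definition upd (r : X -> nat) x v := fun y => if y == x then v else r y.

Variable w : seq bool.

(** [Incr] saturates at the input length, so that no register exceeds [size w] and every loop makes
    at most [size w] rounds. *)
Definition eff (o : op) (s : state) : state :=
  let set x v := State (upd (reg s) x v) (out s) in
  match o with
  | Emit b => State (reg s) (rcons (out s) b)
  | Zero x => set x 0
  | Fill x => set x (size w)
  | Copy x y => set x (reg s y)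
  | Incr x => set x (minn (reg s x).+1 (size w))
  | Lt _ _ | Inp _ => s
  end.

Definition res (o : op) (s : state) : bool :=
  match o with
  | Lt x y => reg s x < reg s y
  | Inp x => nth false w (reg s x)
  | _ => false
  end.

Fixpoint eval (c : cmd) (s : state) : state :=
  match c with
  | Do o => eff o s
  | Seq a b => eval b (eval a s)
  | If t a b => if res t s then eval a (eff t s) else eval b (eff t s)
  | For x y a =>
    iter (reg s y) (fun s' => eff (Incr x) (eval a s')) (eff (Zero x) s)
  end.

Definition op_assigns (o : op) (x : X) : bool :=
  match o with
  | Zero y | Fill y | Copy y _ | Incr y => x == y
  | _ => false
  end.

Fixpoint assigns (c : cmd) (x : X) : bool :=
  match c with
  | Do o => op_assigns o x
  | Seq a b => assigns a x || assigns b x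
  | If t a b => [|| op_assigns t x, assigns a x | assigns b x]
  | For y _ a => (x == y) || assigns a x
  end.

(* Loop variable and bound are constant in the body, so [eval] may fix the
   number of iterations beforehand. *)
Fixpoint wf (c : cmd) : bool :=
  match c with
  | Do _ => true
  | Seq a b | If _ a b => wf a && wf b
  | For x y a => [&& x != y, ~~ assigns a x, ~~ assigns a y & wf a]
  end.

Lemma reg_eff o s x : ~~ op_assigns o x -> reg (eff o s) x = reg s x.
Proof. by case: o => //= [y|y|y z|y] /negbTE xy; rewrite /upd xy. Qed.

Lemma reg_eval c s x : ~~ assigns c x -> reg (eval c s) x = reg s x.
Proof.
elim: c s => [o|a IHa b IHb|t a IHa b IHb|y z a IH] s /=.
- exact: reg_eff.
- by rewrite negb_or => /andP[ax bx]; rewrite IHb // IHa.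
- rewrite !negb_or => /and3P[tx ax bx].
  by case: ifP => _; rewrite ?IHa ?IHb // reg_eff.
- rewrite negb_or => /andP[xy ax].
  elim: (reg s z) => [|k IHk]; first by rewrite /= /upd (negbTE xy).
  by rewrite /= {1}/upd (negbTE xy) IH.
Qed.

Definition bounded (s : state) := forall x, reg s x <= size w.

Lemma bounded_eff o s : bounded s -> bounded (eff o s).
Proof.
by move=> bs x; case: o => //= *; rewrite /upd; case: ifP => // _; rewrite geq_minr.
Qed.

Lemma bounded_iter k (f : state -> state) s :
  (forall s, bounded s -> bounded (f s)) -> bounded s -> bounded (iter k f s).
Proof. by move=> bf bs; elim: k => //= k; apply: bf. Qed.

Lemma bounded_eval c s : bounded s -> bounded (eval c s).
Proof.
elim: c s => [o|a IHa b IHb|t a IHa b IHb|x y a IH] s bs /=.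
- exact: bounded_eff.
- exact/IHb/IHa.
- by case: ifP => _; [apply: IHa | apply: IHb]; apply: bounded_eff.
- apply: bounded_iter; last exact: (bounded_eff (Zero x)).
  by move=> s' bs'; apply: (bounded_eff (Incr x)); apply: IH.
Qed.

(* For a loop, the control points 0, 1 and 2 of ['I_3] reset, test and increment
   the loop variable. *)
Fixpoint ctl (c : cmd) : finType :=
  match c with
  | Do _ => unit
  | Seq a b => (ctl a + ctl b)%type
  | If _ a b => option (ctl a + ctl b)%type
  | For _ _ a => ('I_3 + ctl a)%type
  end.

Fixpoint entry (c : cmd) : ctl c :=
  match c return ctl c with
  | Do _ => tt
  | Seq a b => inl (entry a)
  | If _ a b => None
  | For _ _ a => inl (@Ordinal 3 0 isT)
  end.

Fixpoint opof (c : cmd) : ctl c -> op :=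
  match c return ctl c -> op with
  | Do o => fun=> o
  | Seq a b => fun q => match q with inl q => opof q | inr q => opof q end
  | If t a b => fun q =>
      match q with
      | None => t
      | Some (inl q) => opof q
      | Some (inr q) => opof q
      end
  | For x y a => fun q =>
      match q with
      | inl i => nth (Incr x) [:: Zero x; Lt x y] i
      | inr q => opof q
      end
  end.

Fixpoint next (c : cmd) : ctl c -> bool -> option (ctl c) :=
  match c return ctl c -> bool -> option (ctl c) with
  | Do o => fun _ _ => None
  | Seq a b => fun q r =>
      match q with
      | inl q => Some (if next q r is Some q' then inl q' else inr (entry b))
      | inr q => omap inr (next q r)
      end
  | If t a b => fun q r =>
      match q with
      | None => Some (Some (if r then inl (entry a) else inr (entry b)))
      | Some (inl q) => omap (fun q => Some (inl q)) (next q r)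
      | Some (inr q) => omap (fun q => Some (inr q)) (next q r)
      end
  | For x y a => fun q r =>
      match q with
      | inl i =>
          if i == 1 :> nat then if r then Some (inr (entry a)) else None
          else Some (inl (@Ordinal 3 1 isT))
      | inr q => Some (if next q r is Some q' then inr q'
                       else inl (@Ordinal 3 2 isT))
      end
  end.

(** Small-step execution on the control graph; [n] counts operations exactly, including the one that
    leaves the program. *)
Fixpoint exits (c : cmd) n (q : ctl c) (s s' : state) : Prop :=
  if n is n'.+1 then
    let s1 := eff (opof q) s in
    if next q (res (opof q) s) is Some q' then exits n' q' s1 s'
    else n' = 0 /\ s' = s1
  else False.

Lemma exits_Seqr a b n (q : ctl b) s s' :
  exits n q s s' -> @exits (Seq a b) n (inr q) s s'.
Proof. by elim: n q s => //= n IH q s; case: (next q _) => //= q'; apply: IH. Qed.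

Lemma exits_Seql a b n m (q : ctl a) s s1 s2 :
  exits n q s s1 -> exits m (entry b) s1 s2 ->
  @exits (Seq a b) (n + m) (inl q) s s2.
Proof.
elim: n q s => //= n IH q s.
case: (next q _) => [q'|]; first exact: IH.
by move=> [-> ->]; apply: exits_Seqr.
Qed.

Lemma exits_Ifl t a b n (q : ctl a) s s' :
  exits n q s s' -> @exits (If t a b) n (Some (inl q)) s s'.
Proof. by elim: n q s => //= n IH q s; case: (next q _) => //= q'; apply: IH. Qed.

Lemma exits_Ifr t a b n (q : ctl b) s s' :
  exits n q s s' -> @exits (If t a b) n (Some (inr q)) s s'.
Proof. by elim: n q s => //= n IH q s; case: (next q _) => //= q'; apply: IH. Qed.

Lemma exits_For x y a n m (q : ctl a) s s1 s2 :
  exits n q s s1 ->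
  @exits (For x y a) m (inl (@Ordinal 3 2 isT)) s1 s2 ->
  @exits (For x y a) (n + m) (inr q) s s2.
Proof.
elim: n q s => //= n IH q s.
by case: (next q _) => [q'|] => [|[-> ->]] //; apply: IH.
Qed.

(** The branches of a test are added, which avoids a maximum. A round of a loop adds one test and
    one increment to the body; the final 2 stands for the reset and the failing test. *)
Fixpoint cost (c : cmd) (B : nat) : nat :=
  match c with
  | Do _ => 1
  | Seq a b => cost a B + cost b B
  | If _ a b => (cost a B + cost b B).+1
  | For _ _ a => B * (cost a B).+2 + 2
  end.

Lemma exits_eval c s : wf c -> bounded s ->
  exists2 n, n <= cost c (size w) & exits n (entry c) s (eval c s).
Proof.
elim: c s => [o|a IHa b IHb|t a IHa b IHb|x y a IH] s /=.
- by move=> _ _; exists 1.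
- move=> /andP[wa wb] bs; have [n ln en] := IHa s wa bs.
  have [m lm em] := IHb _ wb (bounded_eval a bs).
  by exists (n + m); [rewrite leq_add | apply: exits_Seql em].
- move=> /andP[wa wb] bs; have bs' := bounded_eff t bs.
  case E: (res t s).
    have [n ln en] := IHa _ wa bs'; exists n.+1; first exact: leq_trans ln (leq_addr _ _).
    by rewrite /= E; apply: exits_Ifl.
  have [n ln en] := IHb _ wb bs'; exists n.+1; first exact: leq_trans ln (leq_addl _ _).
  by rewrite /= E; apply: exits_Ifr.
- move=> /and4P[xy ax ay wa] bs; set K := cost a _.
  (* Induction on the number [k] of rounds left, entering at the test; [k] is the gap between loop
     variable and bound. *)
  have loop k s' : bounded s' -> reg s' y = reg s' x + k ->
    exists2 n, n <= k * K.+2 + 1 &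
      @exits (For x y a) n (inl (@Ordinal 3 1 isT)) s'
        (iter k (fun s' => eff (Incr x) (eval a s')) s').
    elim: k s' => [|k IHk] s' bs' yx.
      by exists 1 => //=; rewrite yx addn0 ltnn.
    have [n ln en] := IH _ wa bs'; rewrite -/K in ln.
    have ba := bounded_eval a bs'.
    have [||m lm em] := IHk (eff (Incr x) (eval a s')).
    + exact: bounded_eff.
    + rewrite /= /upd eqxx eq_sym (negbTE xy) !reg_eval // yx.
      (* The register [y] is at most [size w] and [x] is still below it, so this increment does not
         saturate. *)
      by have := bs' y; rewrite yx => h; rewrite (minn_idPl _) ?addSnnS //; lia.
    exists (n + m.+1).+1; first by lia.
    rewrite iterSr /= yx -[X in X < _]addn0 ltn_add2l /=.
    exact: exits_For en _.
  have [||n ln en] := loop (reg s y) (eff (Zero x) s).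
  + exact: bounded_eff.
  + by rewrite /= /upd eqxx eq_sym (negbTE xy).
  exists n.+1; last exact: en.
  have h : reg s y * K.+2 <= size w * K.+2 by rewrite leq_mul2r bs orbT.
  by lia.
Qed.

Lemma size_out_eff o s : size (out (eff o s)) <= (size (out s)).+1.
Proof. by case: o => //= *; rewrite ?size_rcons. Qed.


(** * Compilation to Turing machines *)

(** The first flag distinguishes the leftmost cell, where a returning head stops. On the input and
    output tracks [None] means past the end of the word. *)
Definition symbol := (bool * option bool * option bool * {ffun X -> bool})%type.

Definition leftmost (a : symbol) := a.1.1.1.
Definition in_track (a : symbol) := a.1.1.2.
Definition out_track (a : symbol) := a.1.2.
Definition mark (a : symbol) := a.2.

Definition blank : symbol := (false, None, None, [ffun=> false]).

Definition cell (s : state) (i : nat) : symbol :=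
  (i == 0, onth w i, onth (out s) i, [ffun x => i < reg s x]).

Definition set_out (b : bool) (a : symbol) : symbol :=
  (leftmost a, in_track a, Some b, mark a).

Definition set_mark (x : X) (b : bool) (a : symbol) : symbol :=
  (leftmost a, in_track a, out_track a,
   [ffun y => if y == x then b else mark a y]).

(* An operation is one sweep from the left end: cells are rewritten by [pass]
   up to the first cell satisfying [stop], or blank; that cell gets [act]. *)
Definition stop (o : op) (a : symbol) : bool :=
  match o with
  | Emit _ => out_track a == None
  | Incr x => (in_track a != None) && ~~ mark a x
  | Lt x y => mark a y && ~~ mark a x
  | Inp x => ~~ mark a x
  | _ => false
  end.

Definition pass (o : op) (a : symbol) : symbol :=
  match o with
  | Zero x => set_mark x false a
  | Fill x => set_mark x (in_track a != None) a
  | Copy x y => set_mark x (mark a y) a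
  | _ => a
  end.

Definition act (o : op) (a : symbol) : symbol :=
  match o with
  | Emit b => set_out b a
  | Incr x => if stop o a then set_mark x true a else a
  | _ => a
  end.

Definition answer (o : op) (a : symbol) : bool :=
  match o with
  | Lt _ _ => stop o a
  | Inp _ => in_track a == Some true
  | _ => false
  end.

Definition halts_sweep o a := stop o a || (a == blank).

Lemma cell_blank s i : (cell s i == blank) =
  [&& i != 0, size w <= i, size (out s) <= i & [forall x, reg s x <= i]].
Proof.
apply/eqP/and4P => [[i0 wi si mi]|[i0 wi si mi]].
  split; [by rewrite i0 | by rewrite -onthNE wi | by rewrite -onthNE si |].
  by apply/forallP => x; move/ffunP: mi => /(_ x); rewrite !ffunE ltnNge => /negbFE.
rewrite /cell /blank (negbTE i0) !onth_default //; congr (_, _).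
apply/ffunP => x; rewrite !ffunE ltnNge.
by move/forallP: mi => ->.
Qed.

(** For a bounded state this is the position of the first blank cell; the 1 is there because cell 0
    carries the flag and is never blank. *)
Definition extent (s : state) := maxn 1 (maxn (size w) (size (out s))).

(** The turning point [p] is the end of the output for [Emit], the value of [x] for [Inp x], for
    [Lt x y] when it holds and for [Incr x] below saturation, and the first blank cell in the
    remaining cases. *)
Lemma sweep_spec o s : bounded s -> exists p,
  [/\ p <= extent s,
      forall i, i < p -> ~~ halts_sweep o (cell s i),
      halts_sweep o (cell s p),
      answer o (cell s p) = res o s &
      forall i, cell (eff o s) i =
        if i < p then pass o (cell s i)
        else if i == p then act o (cell s p) else cell s i].
Proof.
move=> bs.
have nb i : i < extent s -> cell s i != blank.
  rewrite cell_blank /extent => h; apply/negP => /and4P[]; lia.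
have eb : cell s (extent s) == blank.
  rewrite cell_blank /extent; apply/and4P; split; try lia.
  by apply/forallP => x; have := bs x; lia.
have cellE i x : mark (cell s i) x = (i < reg s x) by rewrite /mark ffunE.
have ew : size w <= extent s by rewrite /extent; lia.
have nostop o1 : stop o1 =1 xpred0 -> act o1 =1 id -> answer o1 =1 xpred0 ->
    res o1 s = false ->
    (forall i, cell (eff o1 s) i =
      if i < extent s then pass o1 (cell s i) else cell s i) ->
    exists p, [/\ p <= extent s, forall i, i < p -> ~~ halts_sweep o1 (cell s i),
      halts_sweep o1 (cell s p), answer o1 (cell s p) = res o1 s &
      forall i, cell (eff o1 s) i = if i < p then pass o1 (cell s i)
        else if i == p then act o1 (cell s p) else cell s i].
  move=> st ac an rs ce; exists (extent s); split => //.
  + by move=> i li; rewrite /halts_sweep st nb.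
  + by rewrite /halts_sweep eb orbT.
  + by rewrite an rs.
  + by move=> i; rewrite ce ac; case: eqP => [->|].
have inE i : (in_track (cell s i) != None) = (i < size w).
  by rewrite /in_track /= -onthTE; case: onth.
(* Rewriting the marks of [x] on a region [r] performs the assignment exactly when the marks outside
   [r] are already right. *)
have setE x v r : (forall i, cell (State (upd (reg s) x v) (out s)) i =
      if r i then set_mark x (i < v) (cell s i) else cell s i) <->
      (forall i, ~~ r i -> (i < v) = (i < reg s x)).
  split=> h i.
    by move=> ri; have := congr1 (fun a => mark a x) (h i);
      rewrite (negbTE ri) /mark /= !ffunE /upd eqxx.
  case: ifP => [_|/negbT ri]; rewrite /cell /set_mark; congr (_, _);
    apply/ffunP => y; rewrite !ffunE /upd /mark /= ?ffunE; case: eqP => // -> //.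
  exact: h.
have bx x i : extent s <= i -> (i < reg s x) = false.
  by move=> h; have := bs x; lia.
case: o => [b|x|x|x y|x|x y|x].
- exists (size (out s)); split.
  + by rewrite /extent; lia.
  + move=> i li; rewrite /halts_sweep negb_or nb ?andbT; last by rewrite /extent; lia.
    by rewrite /= /out_track /=; have := onthTE (out s) i; rewrite li; case: onth.
  + by rewrite /halts_sweep /= /out_track /= onth_default // eqxx.
  + by [].
  + move=> i; rewrite /= /cell /= -cats1 onth_cat.
    case: ltngtP => // h.
      suff -> : onth [:: b] (i - size (out s)) = onth (out s) i by [].
      by rewrite !onth_default //=; lia.
    by rewrite h subnn.
- apply: nostop => // i.
  rewrite [LHS](_ : _ = if i < extent s then set_mark x (i < 0) (cell s i)
    else cell s i) //.
  move: i; apply/(setE _ _ (fun i => i < extent s)) => i.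
  by rewrite -leqNgt => h; rewrite bx.
- apply: nostop => // i.
  rewrite /= inE; move: i; apply/(setE _ _ (fun i => i < extent s)) => i.
  by rewrite -leqNgt => h; rewrite bx //; lia.
- apply: nostop => // i.
  rewrite /= cellE; move: i; apply/(setE _ _ (fun i => i < extent s)) => i.
  by rewrite -leqNgt => h; rewrite !bx.
- case: (ltnP (reg s x) (size w)) => hx.
    exists (reg s x); split.
    + lia.
    + move=> i li; rewrite /halts_sweep negb_or nb /=; last by lia.
      by rewrite cellE li andbF.
    + by rewrite /halts_sweep /= inE cellE hx ltnn.
    + by [].
    + move=> i; rewrite /= inE cellE hx ltnn /= (minn_idPl hx).
      transitivity (if i == reg s x then set_mark x (i < (reg s x).+1) (cell s i)
                    else cell s i); last first.
        by case: (ltngtP i (reg s x)) => // ->; rewrite ltnSn.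
      by move: i; apply/(setE _ _ (fun i => i == reg s x)) => i; lia.
  (* A saturated register: every input cell is marked, the sweep runs into the blank, and [act]
     writes nothing there. *)
  have e : reg s x = size w by apply/eqP; rewrite eqn_leq bs.
  exists (extent s); split => //.
  + move=> i li; rewrite /halts_sweep negb_or nb //= inE cellE e.
    by case: (i < size w).
  + by rewrite /halts_sweep eb orbT.
  + move=> i; rewrite /= inE cellE e (_ : (extent s < size w) = false) /=; last by lia.
    have -> : minn (size w).+1 (size w) = reg s x by rewrite e; lia.
    transitivity (cell s i); last by case: ltngtP => // ->.
    rewrite /cell; congr (_, _); apply/ffunP => y; rewrite !ffunE /upd /=.
    by case: eqP => // ->.
- case: (ltnP (reg s x) (reg s y)) => hx; last first.
    exists (extent s); split => //.
    + move=> i li; rewrite /halts_sweep negb_or nb //= !cellE; lia.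
    + by rewrite /halts_sweep eb orbT.
    + rewrite /= !cellE; lia.
    + by move=> i; case: ltngtP => // ->.
  exists (reg s x); split => //.
  + by have := bs x; lia.
  + move=> i li; rewrite /halts_sweep negb_or nb /= ?cellE; last by have := bs x; lia.
    by lia.
  + by rewrite /halts_sweep /= !cellE; apply/orP; left; lia.
  + by rewrite /= !cellE; lia.
  + by move=> i; case: ltngtP => // ->.
- exists (reg s x); split => //.
  + by have := bs x; lia.
  + move=> i li; rewrite /halts_sweep negb_or nb /= ?cellE; last by have := bs x; lia.
    by rewrite li.
  + by rewrite /halts_sweep /= !cellE ltnn.
  + rewrite /= /in_track /= -(odflt_onth false).
    by case: onth => [[]|].
  + by move=> i; case: ltngtP => // ->.
Qed.

Variable c : cmd.

(* [None] is the halting state and [Some None] the initial one;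
   [inl q] sweeps right for [q], [inr (q, r)] returns with answer [r]. *)
Definition tm_state : finType := option (option (ctl c + ctl c * bool)).

Definition sweeping (q : ctl c) : tm_state := Some (Some (inl q)).
Definition returning (q : ctl c) (r : bool) : tm_state := Some (Some (inr (q, r))).

(** The initial state only flags the cell under the head, since input symbols come without the flag.
    A sweep turns with a [DStay] step, so that the turning cell is itself inspected for the flag; it
    may be cell 0. *)
Definition transition (q : tm_state) (a : symbol) : tm_state * symbol * dir :=
  match q with
  | None => (None, a, DStay)
  | Some None =>
      (sweeping (entry c), (true, in_track a, out_track a, mark a), DStay)
  | Some (Some (inl q)) =>
      if halts_sweep (opof q) a then
        (returning q (answer (opof q) a), act (opof q) a, DStay)
      else (sweeping q, pass (opof q) a, DRight)
  | Some (Some (inr (q, r))) =>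
      if leftmost a then (omap (fun q => Some (inl q)) (next q r), a, DStay)
      else (returning q r, a, DLeft)
  end.

Definition compiled : TM := {|
  tm_blank := blank;
  tm_in := fun b => (false, Some b, None, [ffun=> false]);
  tm_out := out_track;
  tm_start := Some None : tm_state;
  tm_halt := None;
  tm_delta := transition |}.

End Language.

(** * Machine configurations as tape functions, up to trailing blanks *)

Section Configurations.

Variable M : TM.

(** Positions are absolute: the left part is stored nearest cell first, hence [rev]. Comparing
    through [nth] with the blank as default ignores explicit trailing blanks. *)
Definition represents (q : tm_st M) p (T : nat -> tm_gam M) (cf : config M) :=
  [/\ cf_st cf = q, size (cf_left cf) = p &
      forall i, nth (tm_blank M) (rev (cf_left cf) ++ cf_right cf) i = T i].

Lemma nth_cat_head (T : Type) (x0 : T) (l r : seq T) i :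
  nth x0 (l ++ head x0 r :: behead r) i = nth x0 (l ++ r) i.
Proof.
case: r => //=; rewrite !nth_cat /=; case: ifP => // _.
by case: (_ - _) => //= n; rewrite !nth_nil.
Qed.

Lemma nth_cat_write (T : Type) (x0 b : T) (l r : seq T) i :
  nth x0 (l ++ b :: behead r) i = if i == size l then b else nth x0 (l ++ r) i.
Proof.
rewrite -(nth_cat_head x0 l r) !nth_cat; case: ltngtP => // h; last by rewrite h subnn.
by rewrite -(subnSK h).
Qed.

Lemma represents_ext q p T T' cf :
  T =1 T' -> represents q p T cf -> represents q p T' cf.
Proof. by move=> e [? ? h]; split=> // i; rewrite h. Qed.

(** The condition [0 < p] excludes a left move at the end of the tape, which [tm_step] turns into
    staying put. *)
Lemma represents_step q p T cf q' b d :
  represents q p T cf -> q != tm_halt M -> tm_delta q (T p) = (q', b, d) ->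
  (if d is DLeft then 0 < p else true) ->
  represents q' (match d with DLeft => p.-1 | DRight => p.+1 | DStay => p end)
    (fun i => if i == p then b else T i) (tm_step cf).
Proof.
case: cf => q0 l r [/= -> <- h] qh.
have hd : T (size l) = head (tm_blank M) r.
  by rewrite -h -(size_rev l) nth_cat ltnn subnn nth0.
rewrite hd /tm_step /= (negbTE qh) => ->.
have wr i : nth (tm_blank M) (rev l ++ b :: behead r) i =
    (if i == size l then b else T i) by rewrite nth_cat_write size_rev h.
case: d; last by move=> _; split.
- case: l h hd wr => //= x l h hd wr _; split => //= i.
  by rewrite -wr rev_cons cat_rcons.
- by move=> _; split => //= i; rewrite -wr rev_cons cat_rcons.
Qed.

Lemma tm_read_prefix (s : seq (tm_gam M)) (y : seq bool) :
  (forall i, tm_out (nth (tm_blank M) s i) = onth y i) -> tm_read s = y.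
Proof.
elim: s y => [|a s IH] y h /=.
  have := h (size y); rewrite nth_nil onth_default // => hb.
  by case: y h => // b y /(_ 0) /=; rewrite hb.
have := h 0; rewrite /=; case: y h => [|b y] h -> //=.
by congr (_ :: _); apply: IH => i; have := h i.+1.
Qed.

End Configurations.

(** * Simulation of loop programs and its running time *)

Section Compilation.

Variables (X : finType) (w : seq bool) (c : cmd X).
Notation M := (compiled c).

(** The steps are [p] moves right, the turn, [p] moves left and the jump to the next operation, with
    [p] at most the extent. *)
Lemma sweep_op (q : ctl c) s (cf : config M) : bounded w s ->
  represents (sweeping q : tm_st M) 0 (cell w s) cf ->
  exists2 t, t <= 2 * (extent w s).+1 &
    represents
      (omap (fun q => Some (inl q)) (next q (res w (opof q) s)) : tm_st M) 0
      (cell w (eff w (opof q) s)) (iter t (@tm_step M) cf).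
Proof.
move=> bs r0; have [p [pe nh hp an ce]] := sweep_spec (opof q) bs.
set o := opof q in nh hp an ce *.
have right j : j <= p -> represents (sweeping q : tm_st M) j
    (fun i => if i < j then pass o (cell w s i) else cell w s i)
    (iter j (@tm_step M) cf).
  elim: j => [_|j IH lj]; first exact: represents_ext r0.
  have /= := @represents_step M _ _ _ _ (sweeping q)
    (pass o (cell w s j)) DRight (IH (ltnW lj)).
  rewrite ltnn /= -/o (negbTE (nh _ lj)) => /(_ isT erefl isT).
  apply: represents_ext => i; rewrite [i < j.+1]ltnS [i <= j]leq_eqVlt.
  by case: eqP => [->|].
have turn : represents (returning q (res w o s) : tm_st M) p (cell w (eff w o s))
    (iter p.+1 (@tm_step M) cf).
  have /= := @represents_step M _ _ _ _ (returning q (res w o s))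
    (act o (cell w s p)) DStay (right p (leqnn p)).
  rewrite ltnn /= -/o hp an => /(_ isT erefl isT).
  by apply: represents_ext => i; rewrite ce; case: ltngtP.
have left j : j <= p -> represents (returning q (res w o s) : tm_st M) (p - j)
    (cell w (eff w o s)) (iter (j + p.+1) (@tm_step M) cf).
  elim: j => [_|j IH lj]; first by rewrite subn0.
  have /= := @represents_step M _ _ _ _ (returning q (res w o s))
    (cell w (eff w o s) (p - j)) DLeft (IH (ltnW lj)).
  rewrite /leftmost /= subn_eq0 leqNgt lj /= subn_gt0 => /(_ isT erefl lj).
  rewrite -subnS; apply: represents_ext => i.
  by case: eqP => // ->; rewrite /cell /= subn_eq0 leqNgt lj.
exists (p + p.+1).+1; first by lia.
have := left p (leqnn p); rewrite subnn => h.
have /= := @represents_step M _ _ _ _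
  (omap (fun q => Some (inl q)) (next q (res w o s))) (cell w (eff w o s) 0) DStay h.
move=> /(_ isT erefl isT).
by apply: represents_ext => i; case: eqP => [->|].
Qed.

Lemma extent_eff (o : op X) (s : state X) : extent w (eff w o s) <= (extent w s).+1.
Proof. by have := size_out_eff w o s; rewrite /extent; lia. Qed.

(** An operation emits at most one symbol, so the extent grows by at most one each time and none of
    the [n] sweeps exceeds [2 * (extent w s + n)] steps. *)
Lemma run_exits n (q : ctl c) s s' (cf : config M) :
  bounded w s -> exits w n q s s' -> represents (sweeping q : tm_st M) 0 (cell w s) cf ->
  exists2 t, t <= n * (2 * (extent w s + n)) &
    represents (None : tm_st M) 0 (cell w s') (iter t (@tm_step M) cf).
Proof.
elim: n q s cf => //= n IH q s cf bs ex r0.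
have [t lt r1] := sweep_op bs r0.
have lex := extent_eff (opof q) s.
case E : (next q _) ex r1 => [q'|] /= => [ex r1|[-> ->] r1]; last first.
  by exists t => //; lia.
have [t' lt' r2] := IH _ _ _ (bounded_eff _ bs) ex r1.
exists (t' + t); last by rewrite iterD.
apply: leq_trans (leq_add lt' lt) _.
have : n * (2 * (extent w (eff w (opof q) s) + n)) <= n * (2 * (extent w s + n.+1)).
  by rewrite leq_mul2l; apply/orP; right; lia.
by lia.
Qed.

Definition init_state : state X := State (fun=> 0) [::].

Lemma compiled_runs : wf c ->
  let N := cost c (size w) in
  runs_in M w (N * (2 * ((size w).+1 + N))).+1 (out (eval w c init_state)).
Proof.
move=> wfc N; have bs : bounded w init_state by [].
have [n ln ex] := exits_eval wfc bs.
have r0 : represents (sweeping (entry c) : tm_st M) 0 (cell w init_state)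
    (tm_step (tm_init M w)).
  have h : represents (tm_start M) 0
     (fun i => nth (blank X) (map (tm_in M) w) i) (tm_init M w) by split.
  have /= := represents_step h isT erefl isT.
  apply: represents_ext => i; rewrite /cell.
  have e : nth (blank X) [seq (false, Some b, None, [ffun=> false]) | b <- w] i
      = (false, onth w i, None, [ffun=> false]) :> symbol X.
    by elim: w i => [|b w' IH] [|i] //=; rewrite ?nth_nil //; apply: IH.
  have z : [ffun x => i < 0] = [ffun=> false] :> {ffun X -> bool}.
    by apply/ffunP => x; rewrite !ffunE.
  case: eqP e => [->|_] e; first by rewrite e /= z.
  by rewrite e /= z onth0n.
have [t lt r1] := run_exits bs ex r0.
exists t.+1.
  rewrite ltnS; apply: leq_trans lt _; apply: leq_mul => //.
  by rewrite /extent /=; lia.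
rewrite iterSr; case: r1 => h1 h2 h3; split => //.
apply: tm_read_prefix => i; have := h3 i.
by rewrite (size0nil h2) /= => ->.
Qed.

End Compilation.

(** * Polynomial bound on the running time *)

Lemma cost_poly (X : finType) (c : cmd X) : exists e, forall B, 0 < B -> cost c B <= B.+1 ^ e.
Proof.
(* For [0 < B] the base [B.+1] is at least 2, so two extra powers give a factor 4, enough for two
   summands and the successor. *)
have sum (f g : nat -> nat) d e : (forall B, 0 < B -> f B <= B.+1 ^ d) ->
    (forall B, 0 < B -> g B <= B.+1 ^ e) ->
    forall B, 0 < B -> (f B + g B).+1 <= B.+1 ^ (maxn d e).+2.
  move=> hf hg B B0.
  have f1 : f B <= B.+1 ^ maxn d e.
    by apply: leq_trans (hf _ B0) _; rewrite leq_exp2l ?leq_maxl //; lia.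
  have g1 : g B <= B.+1 ^ maxn d e.
    by apply: leq_trans (hg _ B0) _; rewrite leq_exp2l ?leq_maxr //; lia.
  have p : 0 < B.+1 ^ maxn d e by rewrite expn_gt0.
  by rewrite !expnS; nia.
elim: c => [o|a [d IHa] b [e IHb]|t a [d IHa] b [e IHb]|x y a [d IHa]] /=.
- by exists 0.
- exists (maxn d e).+2 => B B0; apply: leq_trans (sum _ _ _ _ IHa IHb B B0).
  exact: leqnSn.
- by exists (maxn d e).+2; apply: sum.
- exists d.+3 => B B0; have := IHa B B0.
  have p : 0 < B.+1 ^ d by rewrite expn_gt0.
  rewrite !expnS; move: (cost a B) (B.+1 ^ d) p => C D D0 CD.
  have : B * C.+2 <= B * (3 * D) by rewrite leq_mul2l; apply/orP; right; lia.
  have : B.+1 * (2 * (2 * D)) <= B.+1 * (B.+1 * (B.+1 * D)).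
    by rewrite leq_mul2l !leq_mul //; lia.
  by lia.
Qed.

Lemma compiled_runs_poly (X : finType) (c : cmd X) : wf c ->
  exists e, forall w, 0 < size w ->
    runs_in (compiled c) w ((size w).+1 ^ e) (out (eval w c (init_state X))).
Proof.
(* With s = [(size w).+1] and the cost at most D = s^d, the time is at most 8sD^2. As s is at least
   2, s^4 D^2 already covers this; the exponent 6 leaves room. *)
move=> wfc; have [d hd] := cost_poly c; exists (d + (d + 6)) => w w0.
have [n ln hn] := compiled_runs w wfc; exists n => //.
apply: leq_trans ln _; have := hd _ w0.
move: (cost c _) => C CD; have D0 : 0 < (size w).+1 ^ d by rewrite expn_gt0.
have s0 : 1 < (size w).+1 by [].
rewrite 2!expnD !expnS; move: (size w).+1 ((size w).+1 ^ d) s0 D0 CD => s D s0 D0 CD.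
have h1 : C * (2 * (s + C)) <= D * (2 * (s + D)).
  by rewrite leq_mul // leq_mul // leq_add.
have h2 : s + D <= 2 * (s * D) by nia.
have h3 : D * (2 * (s + D)) <= D * (2 * (2 * (s * D))) by rewrite !leq_mul.
have h4 : 8 * (s * (D * D)) <= (s * (s * s)) * (s * (D * D)).
  by rewrite leq_mul2r; apply/orP; right; nia.
have h5 : 0 < s * (D * D) by nia.
have h6 : s * (s * s) * (s * (D * D)) <= s * s * (s * (s * s) * (s * (D * D))).
  by rewrite leq_pmull //; nia.
rewrite expn0; lia.
Qed.

(** * Specifications of program fragments *)

Section ProgramLogic.

Variables (X : finType) (w : seq bool).
Implicit Types (x y z : X) (c : cmd X) (s : state X).
Notation bounded := (bounded w).

Lemma eval_Do o s : eval w (Do o) s = eff w o s.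
Proof. by []. Qed.

Lemma eval_Seq a b s : eval w (Seq a b) s = eval w b (eval w a s).
Proof. by []. Qed.

Lemma eval_If t a b s :
  eval w (If t a b) s = eval w (if res w t s then a else b) (eff w t s).
Proof. by rewrite /eval -/(eval w); case: ifP. Qed.

Global Opaque eval.

Lemma upd_eq (r : X -> nat) x v : upd r x v x = v.
Proof. by rewrite /upd eqxx. Qed.

Lemma flatten_mkseqS (T : Type) (g : nat -> seq T) n :
  flatten (mkseq g n.+1) = flatten (mkseq g n) ++ g n.
Proof. by rewrite /mkseq -addn1 iotaD map_cat flatten_cat /= cats0. Qed.

(** Loop rule: [inv i] holds at the test with loop variable [i], and [g i] is the output of round
    [i]. The body may rely on every register that the loop does not assign. *)
Lemma For_spec x y c s (inv : nat -> state X -> Prop) (g : nat -> seq bool) :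
  wf (For x y c) -> bounded s -> inv 0 (eff w (Zero x) s) ->
  (forall i s', i < reg s y -> bounded s' ->
     (forall z, ~~ assigns (For x y c) z -> reg s' z = reg s z) ->
     reg s' x = i -> inv i s' ->
     inv i.+1 (eff w (Incr x) (eval w c s')) /\
     out (eval w c s') = out s' ++ g i) ->
  inv (reg s y) (eval w (For x y c) s) /\
  out (eval w (For x y c) s) = out s ++ flatten (mkseq g (reg s y)).
Proof.
move=> /= /and4P[xy ax ay wc] bs i0 ind.
pose f s' := eff w (Incr x) (eval w c s').
pose F i := iter i f (eff w (Zero x) s).
suff loop i : i <= reg s y ->
    [/\ bounded (F i), forall z, ~~ assigns (For x y c) z -> reg (F i) z = reg s z,
        reg (F i) x = i, inv i (F i) & out (F i) = out s ++ flatten (mkseq g i)].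
  by have [] := loop _ (leqnn _).
elim: i => [_|i IH li].
  split => //; last by rewrite /F /= cats0.
  - exact: (bounded_eff (Zero x)).
  - by move=> z; rewrite negb_or /F /= /upd => /andP[/negbTE ->].
  - by rewrite /F /= upd_eq.
have [b1 fr ri ii oi] := IH (ltnW li).
have [i1 o1] := ind _ _ li b1 fr ri ii.
split => //.
- by apply: (bounded_eff (Incr x)); apply: bounded_eval.
- move=> z za; have := za; rewrite negb_or {1}/F /= {1}/upd => /andP[/negbTE -> za'].
  by rewrite reg_eval // fr.
- rewrite {1}/F /= upd_eq reg_eval // -/(F i) ri (minn_idPl _) //.
  by have := bs y; lia.
- by rewrite flatten_mkseqS catA -oi -o1.
Qed.

Lemma out_For x y c s (g : nat -> seq bool) :
  wf (For x y c) -> bounded s ->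
  (forall i s', i < reg s y -> bounded s' ->
     (forall z, ~~ assigns (For x y c) z -> reg s' z = reg s z) ->
     reg s' x = i -> out (eval w c s') = out s' ++ g i) ->
  out (eval w (For x y c) s) = out s ++ flatten (mkseq g (reg s y)).
Proof.
move=> wc bs h; have [] := @For_spec x y c s (fun _ _ => True) g wc bs I _ => //.
by move=> i s' li b' fr ri _; split => //; apply: h.
Qed.

Lemma flatten_nseq1 (T : Type) (a : T) n : flatten (mkseq (fun=> [:: a]) n) = nseq n a.
Proof.
by elim: n => // n IH; rewrite flatten_mkseqS IH -[[:: a]]/(nseq 1 a) -nseqD addn1.
Qed.

Definition num (t x : X) : cmd X :=
  Seq (For t x (Do (Emit X true))) (Do (Emit X false)).

Lemma out_num t x s : t != x -> bounded s ->
  out (eval w (num t x) s) = out s ++ enc_nat (reg s x).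
Proof.
move=> tx bs; rewrite eval_Seq eval_Do /=.
rewrite (@out_For _ _ _ _ (fun=> [:: true])) //=; last first.
- by move=> *; rewrite eval_Do /= cats1.
- by rewrite tx.
by rewrite flatten_nseq1 rcons_cat.
Qed.

(** The product may exceed [size w] and then fits in no register; nested loops write it directly in
    unary. *)
Definition idx (a b r x y : X) : cmd X :=
  Seq (For a x (For b r (Do (Emit X true)))) (num a y).

Lemma out_idx a b r x y s :
  uniq [:: a; b; r] -> x \notin [:: a; b] -> y \notin [:: a; b] -> bounded s ->
  out (eval w (idx a b r x y) s) = out s ++ enc_nat (reg s x * reg s r + reg s y).
Proof.
rewrite /= !inE !negb_or !andbT => /andP[/andP[ab ar] br] /andP[xa xb] /andP[ya yb] bs.
rewrite eval_Seq out_num; [|by rewrite eq_sym|exact: bounded_eval].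
rewrite reg_eval /= ?negb_or ?ya ?yb //.
rewrite (@out_For _ _ _ _ (fun=> nseq (reg s r) true)) //=; last first.
- move=> i s' li bs' fr _.
  rewrite (@out_For _ _ _ _ (fun=> [:: true])) //=; last first.
  + by move=> *; rewrite eval_Do /= cats1.
  + by rewrite br.
  by rewrite flatten_nseq1 fr //= !negb_or eq_sym ar eq_sym br.
- by rewrite !orbF eq_sym xa ab xb br.
rewrite -catA; congr (_ ++ _); rewrite /enc_nat -rcons_cat; congr rcons.
rewrite nseqD; congr (_ ++ _).
by elim: (reg s x) => // n IH; rewrite flatten_mkseqS IH -nseqD mulSn addnC.
Qed.

Definition skip (x : X) : cmd X := Do (Lt x x).

(** A bounded loop replaces a while loop: all rounds are made, and once [p] stands on the terminator
    [false] they do nothing. The last increment skips the terminator. *)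
Definition read (t p l x : X) : cmd X :=
  Seq (Do (Zero x))
    (Seq (For t l (If (Inp p) (Seq (Do (Incr x)) (Do (Incr p))) (skip x)))
       (Do (Incr p))).

Lemma read_spec t p l x s a rest :
  uniq [:: t; p; l; x] -> bounded s -> reg s l = size w ->
  drop (reg s p) w = enc_nat a ++ rest ->
  let s' := eval w (read t p l x) s in
  [/\ reg s' x = a, drop (reg s' p) w = rest & out s' = out s].
Proof.
rewrite /= !inE !negb_or !andbT => /and3P[/and3P[tp tl tx] /andP[pl px] lx] bs rl dw.
have sym y z : y != z -> (z == y) = false by rewrite eq_sym => /negbTE.
have ne := (negbTE tp, negbTE tl, negbTE tx, negbTE pl, negbTE px, negbTE lx,
  sym _ _ tp, sym _ _ tl, sym _ _ tx, sym _ _ pl, sym _ _ px, sym _ _ lx).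
(* The number and its terminator lie within the input, so the increments of [p] are not truncated,
   even if nothing follows. *)
have sz : reg s p + (a.+1 + size rest) = size w.
  have := congr1 size dw; rewrite size_drop size_cat size_rcons size_nseq.
  by have := bs p; lia.
rewrite eval_Seq eval_Seq eval_Do eval_Do /=.
set s0 := State (upd (reg s) x 0) (out s).
have bs0 : bounded s0 by exact: (bounded_eff (Zero x)).
set c := If _ _ _.
have s0r z : z != x -> reg s0 z = reg s z by rewrite /= /upd => /negbTE ->.
(* After [i] rounds [minn i a] marks have been consumed; [size w] rounds suffice, since [a] is
   smaller. *)
have [] := @For_spec t l c s0
  (fun i s' => reg s' x = minn i a /\ reg s' p = reg s p + minn i a) (fun=> [::]) _ bs0.
- by rewrite /= !ne.
- by rewrite /= /upd eqxx min0n addn0 !ne.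
- move=> i s' li bs' fr rt [rx rp].
  have nw : nth false w (reg s' p) = (i < a).
    rewrite rp -nth_drop dw nth_cat size_rcons size_nseq ltnS geq_minr.
    rewrite nth_rcons size_nseq nth_nseq.
    by case: ltnP => h; case: ltnP; try lia; rewrite ?if_same.
  rewrite /c eval_If /= nw; case: ltnP => ia.
    rewrite eval_Seq !eval_Do /= cats0; split => //.
    rewrite /upd !eqxx !ne rx rp.
    by lia.
  rewrite eval_Do /= cats0; split => //.
  by rewrite /upd !ne rx rp; lia.
rewrite s0r ?ne // rl => [[rx rp] ->]; split.
- by rewrite /upd !ne rx; lia.
- rewrite upd_eq rp (_ : minn _ _ = (a.+1) + reg s p); last by lia.
  by rewrite -drop_drop dw drop_size_cat // size_rcons size_nseq.
- elim: (size w) => [|n IH]; first by rewrite cats0.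
  by rewrite flatten_mkseqS cats0.
Qed.

End ProgramLogic.

(** * The reduction *)

Notation var := 'I_20.
Notation var_at i := (@Ordinal 20 i isT).
Notation vn := (var_at 0).
Notation vm := (var_at 1).
Notation vk := (var_at 2).
Notation vwidth := (var_at 3).
Notation vcols := (var_at 4).
Notation vzero := (var_at 5).
Notation vlen := (var_at 6).
Notation vedges := (var_at 7).
Notation vpos := (var_at 8).
Notation vitem := (var_at 9).
Notation vsize := (var_at 10).
Notation vt := (var_at 11).
Notation vu := (var_at 12).
Notation vi := (var_at 13).
Notation vnext := (var_at 14).
Notation vv := (var_at 15).
Notation vfound := (var_at 16).
Notation va := (var_at 17).
Notation vb := (var_at 18).
Notation vcur := (var_at 19).

Notation "a ;; b" := (Seq a b) (at level 61, right associativity).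

Definition read_to (x : var) : cmd var := read vt vpos vlen x.
Definition emit_num (x : var) : cmd var := num vt x.
Definition emit_idx (x y : var) : cmd var := idx va vb vwidth x y.
Definition emit (b : bool) : cmd var := Do (Emit var b).

(** Equality of [vv] and an item is the failure of both strict comparisons. The position ends behind
    the edge whatever the answer, so the same fragment also serves to skip edges. *)
Definition scan_edge : cmd var :=
  Do (Zero vfound) ;; read_to vsize ;;
  For vu vsize (read_to vitem ;;
    If (Lt vitem vv) (skip vv) (If (Lt vv vitem) (skip vv) (Do (Incr vfound)))).

(** The parameter follows the edges in the input, so these are first skipped; [vedges] keeps their
    position for a later pass. *)
Definition parse : cmd var :=
  Do (Fill vlen) ;; read_to vn ;; read_to vm ;; Do (Copy vedges vpos) ;;
  For vi vm scan_edge ;; read_to vk ;;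
  Do (Copy vwidth vn) ;; Do (Incr vwidth) ;;
  Do (Copy vcols vn) ;; For vi vm (Do (Incr vcols)).

(** The last number, (n + m)(n + 1), is the length of the transition table. *)
Definition emit_header : cmd var :=
  emit_num vk ;; emit_num vn ;; emit_idx vcols vzero.

Definition emit_choice : cmd var :=
  For vi vn (Do (Copy vnext vi) ;; Do (Incr vnext) ;;
    For vv vwidth (emit_idx vnext vv ;;
      If (Lt vv vn) (emit_idx vcols vn) (emit_idx vnext vi))).

(** Each edge is scanned anew for every [v], from the position saved in [vcur]; the position after
    the last scan is the start of the next edge. *)
Definition emit_edges : cmd var :=
  Do (Copy vnext vn) ;; Do (Copy vcur vedges) ;;
  For vi vm (Do (Incr vnext) ;;
    For vv vwidth (Do (Copy vpos vcur) ;; emit_idx vnext vv ;; scan_edge ;;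
      If (Lt vzero vfound) (emit_idx vnext vv) (emit_idx vcols vn)) ;;
    Do (Copy vcur vpos)).

Definition emit_acc : cmd var :=
  emit_num vn ;; For vv vn (emit_idx vcols vv).

(** The constants are spelled out: [false] is the code of 0, and [true] followed by [false] that of
    1. *)
Definition emit_gcc : cmd var :=
  emit_num vcols ;;
  For vi vn (emit false ;; emit_num vk ;; emit false ;; emit true ;; emit false) ;;
  For vi vm (emit false ;; emit_num vk ;; emit true ;; emit false ;; emit_num vk).

Definition reduction : cmd var :=
  parse ;; emit_header ;; emit_choice ;; emit_edges ;; emit_acc ;; emit_gcc.

(** * Output of the program on an encoded hypergraph *)

Section Reduction.

Variable I : HSInst.
Let w := enc_hs I.
Let n := hs_n I.
Let es := hs_edges I.
Let m := size es.
Let k := hs_k I.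

Definition rest (i : nat) : seq bool :=
  flatten (map (enc_seq enc_nat) (drop i es)) ++ enc_nat k.

Lemma scan_edge_spec s e r :
  bounded w s -> reg s vlen = size w ->
  drop (reg s vpos) w = enc_seq enc_nat e ++ r ->
  let s' := eval w scan_edge s in
  [/\ (0 < reg s' vfound) = (reg s vv \in e),
      drop (reg s' vpos) w = r & out s' = out s].
Proof.
move=> bs ls; rewrite -catA => ds s_end; rewrite /s_end /scan_edge eval_Seq eval_Seq eval_Do.
set s0 := eff w _ s; have b0 : bounded w s0 by exact: bounded_eff.
have [//||||s1 d1 o1] := @read_spec _ w vt vpos vlen vsize s0 (size e)
  (flatten (map enc_nat e) ++ r).
- exact: b0.
- by rewrite reg_eff.
- by rewrite reg_eff.
have b1 : bounded w (eval w (read_to vsize) s0) by exact: bounded_eval.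
(* The input is nonempty, so the saturating increment of [vfound] yields a positive value. *)
have w0 : 0 < size w.
  have := congr1 size ds; rewrite size_drop size_cat size_rcons.
  by lia.
have [] := @For_spec _ w vu vsize
  (read_to vitem ;; If (Lt vitem vv) (skip vv)
     (If (Lt vv vitem) (skip vv) (Do (Incr vfound)))) _
  (fun i s' => drop (reg s' vpos) w = flatten (map enc_nat (drop i e)) ++ r /\
     (0 < reg s' vfound) = (reg s vv \in take i e)) (fun=> [::]) isT b1.
- split; first by rewrite drop0 reg_eff.
  by rewrite reg_eff // reg_eval // /= upd_eq take0.
- move=> i s' li bs' fr ri [dp fo]; rewrite s1 in li.
  rewrite (drop_nth 0 li) /= -catA in dp.
  have [//||q1 q2 q3] := @read_spec _ w vt vpos vlen vitem s' _ _ _ bs' _ dp.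
    by rewrite fr // reg_eval.
  rewrite eval_Seq; set s2 := eval w (read_to vitem) s' in q1 q2 q3 *.
  have qv : reg s2 vv = reg s vv.
    by rewrite reg_eval // fr // reg_eval // reg_eff.
  have qf : reg s2 vfound = reg s' vfound by rewrite reg_eval.
  have me : (reg s vv \in take i.+1 e) = (reg s vv \in take i e) || (reg s vv == nth 0 e i).
    by rewrite (take_nth 0 li) mem_rcons in_cons orbC.
  rewrite reg_eff // reg_eff // me -fo -qf cats0 eval_If /= q1 qv.
  case: ltngtP => h.
  + by rewrite eval_Do /= orbF.
  + by rewrite eval_If /= q1 qv h eval_Do /= orbF.
  + rewrite eval_If /= q1 qv h ltnn eval_Do /= upd_eq orbT.
    by split; [split; [exact: q2 | lia] | exact: q3].
rewrite s1 => [[dp fo] oo]; rewrite drop_size take_size in dp fo.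
split => //; rewrite oo o1 /=.
by elim: (size e) => [|j IH]; rewrite ?flatten_mkseqS ?cats0 // -IH ?cats0.
Qed.

(** Common precondition of the emitting fragments: [parse] establishes it, and it persists since
    none of them assigns these eight registers. *)
Record ready (s : state var) : Prop := Ready {
  ready_bounded : bounded w s;
  ready_n : reg s vn = n;
  ready_m : reg s vm = m;
  ready_k : reg s vk = k;
  ready_width : reg s vwidth = n.+1;
  ready_cols : reg s vcols = n + m;
  ready_zero : reg s vzero = 0;
  ready_len : reg s vlen = size w;
  ready_edges : drop (reg s vedges) w = rest 0 }.

Definition keeps_parsed (c : cmd var) : bool :=
  all (fun x => ~~ assigns c x)
    [:: vn; vm; vk; vwidth; vcols; vzero; vlen; vedges].

Lemma ready_frame c s s' : keeps_parsed c -> ready s -> bounded w s' ->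
  (forall x, ~~ assigns c x -> reg s' x = reg s x) -> ready s'.
Proof.
move=> /and5P[h0 h1 h2 h3] /and5P[h4 h5 h6 h7 _].
by case=> b e0 e1 e2 e3 e4 e5 e6 e7 b' fr; split; rewrite ?fr.
Qed.

Lemma ready_eval c s : keeps_parsed c -> ready s -> ready (eval w c s).
Proof.
move=> kc r; apply: ready_frame kc r (bounded_eval c (ready_bounded r)) _.
by move=> x; apply: reg_eval.
Qed.

Lemma rest_edge i : i < m -> rest i = enc_seq enc_nat (nth [::] es i) ++ rest i.+1.
Proof. by move=> li; rewrite /rest (drop_nth [::] li) /= -catA. Qed.

(** The unary codes of [n] and [m] alone suffice for this. Hence [n.+1] and all column indices fit
    in a register without saturation. *)
Lemma size_edges : n + m < size w.
Proof.
rewrite /w /enc_hs /enc_seq !size_cat !size_rcons !size_nseq -/es -/m -/n.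
by lia.
Qed.

Lemma parse_spec : let s := eval w parse (init_state var) in ready s /\ out s = [::].
Proof.
have hw : w = enc_nat n ++ enc_nat m ++ rest 0.
  by rewrite /rest drop0 /w /enc_hs /enc_seq -!catA.
have hL := size_edges.
rewrite /parse /=.
rewrite eval_Seq eval_Do; set s1 := eff _ _ _.
have b1 : bounded w s1 by apply: bounded_eff.
rewrite eval_Seq.
have [//||n2 p2 o2] := @read_spec _ w vt vpos vlen vn s1 n (enc_nat m ++ rest 0) isT b1.
  by rewrite /= drop0.
set s2 := eval w _ s1 in n2 p2 o2 *.
have b2 : bounded w s2 by apply: bounded_eval.
rewrite eval_Seq.
have [|m3 p3 o3] := @read_spec _ w vt vpos vlen vm s2 m (rest 0) isT b2 _ p2.
  by rewrite reg_eval.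
set s3 := eval w _ s2 in m3 p3 o3 *.
have b3 : bounded w s3 by apply: bounded_eval.
rewrite eval_Seq eval_Do; set s4 := eff _ _ s3.
have b4 : bounded w s4 by apply: bounded_eff.
rewrite eval_Seq.
have [] := @For_spec _ w vi vm scan_edge s4
  (fun i s' => drop (reg s' vpos) w = rest i) (fun=> [::]) isT b4.
- by rewrite reg_eff // reg_eff.
- move=> i s' li bs' fr ri dp; rewrite reg_eff // m3 in li.
  rewrite rest_edge // in dp.
  have [|_ d5 o5] := scan_edge_spec bs' _ dp.
    by rewrite fr // reg_eff // reg_eval // reg_eval.
  by rewrite reg_eff // d5 o5 cats0.
set s5 := eval w _ s4; rewrite reg_eff // m3 => p5 o5.
have b5 : bounded w s5 by apply: bounded_eval.
rewrite /rest drop_size /= -[enc_nat k]cats0 in p5.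
rewrite eval_Seq.
have [|k6 p6 o6] := @read_spec _ w vt vpos vlen vk s5 k [::] isT b5 _ p5.
  by rewrite reg_eval // reg_eff // reg_eval // reg_eval.
set s6 := eval w _ s5 in k6 p6 o6 *.
have b6 : bounded w s6 by apply: bounded_eval.
have n6 : reg s6 vn = n by rewrite reg_eval // reg_eval // reg_eff // reg_eval.
have m6 : reg s6 vm = m by rewrite reg_eval // reg_eval // reg_eff.
rewrite eval_Seq eval_Do; set s7 := eff _ _ s6.
have b7 : bounded w s7 by apply: bounded_eff.
rewrite eval_Seq eval_Do; set s8 := eff _ _ s7.
have b8 : bounded w s8 by apply: bounded_eff.
rewrite eval_Seq eval_Do; set s9 := eff _ _ s8.
have b9 : bounded w s9 by apply: bounded_eff.
have [] := @For_spec _ w vi vm (Do (Incr vcols)) s9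
  (fun i s' => reg s' vcols = n + i) (fun=> [::]) isT b9.
- by rewrite reg_eff // /= upd_eq /upd /= n6 addn0.
- move=> i s' li bs' fr ri dp; rewrite reg_eff // eval_Do /= upd_eq dp cats0.
  by rewrite 3?reg_eff // m6 in li; split => //; lia.
set s10 := eval w _ s9; rewrite 3?reg_eff // m6 => c10 o10.
split; last first.
  rewrite o10 /= o6 o5 /= o3 o2 /=.
  by elim: m => // j; rewrite !flatten_mkseqS !cats0.
split => //; first by apply: bounded_eval.
- by rewrite reg_eval // 3?reg_eff.
- by rewrite reg_eval // 3?reg_eff.
- by rewrite reg_eval // 3?reg_eff.
- by rewrite reg_eval // reg_eff // /= upd_eq /upd /= n6; lia.
- by rewrite reg_eval // 3?reg_eff // 2?reg_eval // reg_eff // 2?reg_eval.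
- by rewrite reg_eval // 3?reg_eff // 2?reg_eval // reg_eff // 2?reg_eval.
- by rewrite reg_eval // 3?reg_eff // 2?reg_eval // /= upd_eq.
Qed.

(* State of a row that has read [j] columns and chosen vertex [v], where [v = n]
   means none yet; a row that ends without a choice is as good as dead. *)
Definition state_of j v := j * n.+1 + v.
Definition dead := state_of (n + m) n.
Definition on_true j v :=
  if j < n then if v < n then dead else state_of j.+1 j
  else if v \in nth [::] es (j - n) then state_of j.+1 v else dead.
Definition moves j v := (state_of j.+1 v, on_true j v).

(** The table index is decoded by division by [n.+1]. The states with column index [n + m], namely
    the accepting ones and [dead], lie past the end of the table and are therefore sinks. *)
Definition instance : RGInst := {|
  rg_R := k;
  rg_dfa := {|
    dfa_start := n;
    dfa_trans := mkseq (fun x => moves (x %/ n.+1) (x %% n.+1)) ((n + m) * n.+1);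
    dfa_acc := mkseq (state_of (n + m)) n |};
  rg_gcc := nseq n (0, k, 0, 1) ++ nseq m (0, k, 1, k) |}.

Lemma out_emit_num x s : vt != x -> ready s ->
  out (eval w (emit_num x) s) = out s ++ enc_nat (reg s x).
Proof. by move=> tx r; rewrite out_num //; apply: ready_bounded. Qed.

Lemma out_emit_idx x y s : x \notin [:: va; vb] -> y \notin [:: va; vb] -> ready s ->
  out (eval w (emit_idx x y) s) = out s ++ enc_nat (state_of (reg s x) (reg s y)).
Proof.
by move=> hx hy r; rewrite out_idx ?(ready_width r) //; apply: ready_bounded.
Qed.

Lemma out_emit_header s : ready s ->
  out (eval w emit_header s) =
    out s ++ enc_nat k ++ enc_nat n ++ enc_nat ((n + m) * n.+1).
Proof.
move=> r; rewrite /emit_header eval_Seq eval_Seq.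
have r1 : ready (eval w (emit_num vk) s) by exact: ready_eval.
have r2 : ready (eval w (emit_num vn) (eval w (emit_num vk) s)) by exact: ready_eval.
rewrite out_emit_idx // out_emit_num // out_emit_num // -!catA.
by rewrite (ready_k r) (ready_n r1) (ready_cols r2) (ready_zero r2) /state_of addn0.
Qed.

Lemma out_emit_choice s : ready s ->
  out (eval w emit_choice s) = out s ++
    flatten (mkseq (fun j => flatten (mkseq (fun v => enc_pair (moves j v)) n.+1)) n).
Proof.
move=> r; rewrite -{2}(ready_n r); apply: out_For => //; first exact: ready_bounded.
move=> j s1 lj b1 fr rj; have r1 := ready_frame (c := emit_choice) isT r b1 fr.
rewrite (ready_n r) in lj.
rewrite eval_Seq eval_Do eval_Seq eval_Do.
set s2 := eff _ _ s1; set s3 := eff _ _ s2.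
have r3 : ready s3.
  apply: (@ready_eval (Do (Incr vnext))) => //.
  exact: (@ready_eval (Do (Copy vnext vi))).
have n3 : reg s3 vnext = j.+1.
  by rewrite /= !upd_eq rj; have := size_edges; lia.
have i3 : reg s3 vi = j by rewrite -rj.
rewrite -(ready_width r3).
apply: (@out_For _ w vv vwidth _ s3) => //; first exact: ready_bounded.
clearbody s3; move=> v s4 lv b4 fr4 rv.
have r4 := ready_frame (c := For vv vwidth (emit_idx vnext vv ;;
      If (Lt vv vn) (emit_idx vcols vn) (emit_idx vnext vi))) isT r3 b4 fr4.
rewrite eval_Seq eval_If; set s5 := eval w _ s4.
have r5 : ready s5 by exact: ready_eval.
have -> : eff w (Lt vv vn) s5 = s5 by [].
have -> : res w (Lt vv vn) s5 = (v < n).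
  by rewrite /res (ready_n r5) reg_eval // rv.
rewrite /enc_pair /moves /on_true lj catA.
have o5 : out s5 = out s4 ++ enc_nat (state_of j.+1 v).
  by rewrite out_emit_idx // rv fr4 // n3.
case: ifP => _; rewrite out_emit_idx // o5.
  by rewrite (ready_cols r5) (ready_n r5).
by rewrite reg_eval // fr4 // n3 reg_eval // fr4 // i3.
Qed.

Lemma out_emit_edges s : ready s ->
  out (eval w emit_edges s) = out s ++
    flatten (mkseq (fun i => flatten (mkseq (fun v => enc_pair (moves (n + i) v)) n.+1)) m).
Proof.
move=> r; rewrite /emit_edges eval_Seq eval_Do eval_Seq eval_Do.
set s2 := eff _ _ s; set s3 := eff _ _ s2.
have r2 : ready s2 by exact: (@ready_eval (Do (Copy vnext vn))).
have r3 : ready s3 by exact: (@ready_eval (Do (Copy vcur vedges))).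
have o3 : out s3 = out s by [].
have n3 : reg s3 vnext = n by rewrite /= /upd /= (ready_n r).
have c3 : drop (reg s3 vcur) w = rest 0 by rewrite /= upd_eq (ready_edges r2).
clearbody s3; rewrite -o3 -(ready_m r3).
set body := _ ;; _.
apply: (proj2 (@For_spec _ w vi vm body s3
  (fun i s' => reg s' vnext = n + i /\ drop (reg s' vcur) w = rest i)
  (fun i => flatten (mkseq (fun v => enc_pair (moves (n + i) v)) n.+1))
  isT (ready_bounded r3) _ _)).
  by rewrite reg_eff // reg_eff // addn0.
move=> i s4 li b4 fr4 ri [n4 c4].
have r4 := ready_frame (c := For vi vm body) isT r3 b4 fr4.
rewrite (ready_m r3) in li; have sw := size_edges.
rewrite [eval w body s4]eval_Seq eval_Do.
set s5 := eff _ _ s4.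
have r5 : ready s5 by exact: (@ready_eval (Do (Incr vnext))).
have n5 : reg s5 vnext = (n + i).+1 by rewrite /= upd_eq n4; lia.
have c5 : drop (reg s5 vcur) w = rest i by [].
have -> : out s4 = out s5 by [].
clearbody s5; rewrite eval_Seq eval_Do /=.
set inner := For vv _ _; set s6 := eval w inner s5.
have n6 : reg s6 vnext = (n + i).+1 by rewrite reg_eval.
rewrite rest_edge // in c5.
(* The position is past the edge only after one round, hence the guard [0 < v]; the loop makes
   [n.+1] rounds. *)
have [] := @For_spec _ w vv vwidth _ s5
  (fun v s' => 0 < v -> drop (reg s' vpos) w = rest i.+1)
  (fun v => enc_pair (moves (n + i) v))
  (isT : wf inner) (ready_bounded r5); rewrite -?/inner -?/s6 //.
  move=> v s7 lv b7 fr7 rv _.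
  have r7 := ready_frame (c := inner) isT r5 b7 fr7.
  rewrite eval_Seq eval_Do; set s8 := eff _ _ s7.
  have r8 : ready s8 by exact: (@ready_eval (Do (Copy vpos vcur))).
  have p8 : drop (reg s8 vpos) w = enc_seq enc_nat (nth [::] es i) ++ rest i.+1.
    by rewrite /= upd_eq fr7.
  have v8 : reg s8 vv = v by rewrite -rv.
  have n8 : reg s8 vnext = (n + i).+1 by rewrite -n5 -fr7.
  have -> : out s7 = out s8 by [].
  clearbody s8; rewrite eval_Seq; set s9 := eval w _ s8.
  have r9 : ready s9 by exact: ready_eval.
  have o9 : out s9 = out s8 ++ enc_nat (state_of (n + i).+1 v).
    by rewrite out_emit_idx // v8 n8.
  have v9 : reg s9 vv = v by rewrite reg_eval.
  have n9 : reg s9 vnext = (n + i).+1 by rewrite reg_eval.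
  have p9 : reg s9 vpos = reg s8 vpos by rewrite reg_eval.
  clearbody s9; rewrite -p9 in p8.
  rewrite eval_Seq.
  have [f10 p10 o10] := scan_edge_spec (ready_bounded r9) (ready_len r9) p8.
  have r10 : ready (eval w scan_edge s9) by exact: ready_eval.
  have v10 : reg (eval w scan_edge s9) vv = v by rewrite reg_eval.
  have n10 : reg (eval w scan_edge s9) vnext = (n + i).+1 by rewrite reg_eval.
  move: (eval w scan_edge s9) f10 p10 o10 r10 v10 n10 => s10 f10 p10 o10 r10 v10 n10.
  rewrite eval_If.
  have -> : eff w (Lt vzero vfound) s10 = s10 by [].
  have -> : res w (Lt vzero vfound) s10 = (v \in nth [::] es i).
    by rewrite /res (ready_zero r10) f10 v9.
  split.
    by move=> _; case: ifP => _; rewrite reg_eff // reg_eval.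
  have -> : enc_pair (moves (n + i) v) = enc_nat (state_of (n + i).+1 v) ++
      enc_nat (if v \in nth [::] es i then state_of (n + i).+1 v else dead).
    by rewrite /enc_pair /moves /on_true [n + i < n]ltnNge leq_addr addKn.
  rewrite catA -o9 -o10.
  case: ifP => _; rewrite out_emit_idx //.
    by rewrite v10 n10.
  by rewrite (ready_cols r10) (ready_n r10).
rewrite (ready_width r5) => p6 o6; split; last exact: o6.
by split; [rewrite /upd /= n6 addnS | rewrite /upd /= p6].
Qed.

Lemma out_emit_acc s : ready s ->
  out (eval w emit_acc s) = out s ++ enc_seq enc_nat (mkseq (state_of (n + m)) n).
Proof.
move=> r; rewrite /emit_acc eval_Seq.
have r1 : ready (eval w (emit_num vn) s) by exact: ready_eval.
rewrite (@out_For _ w vv vn _ _ (fun v => enc_nat (state_of (n + m) v))) //.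
- rewrite out_emit_num // (ready_n r) (ready_n r1) -catA; congr (_ ++ _).
  by rewrite /enc_seq size_mkseq /mkseq -map_comp.
- exact: ready_bounded.
- move=> v s2 lv b2 fr rv.
  have r2 := ready_frame (c := For vv vn (emit_idx vcols vv)) isT r1 b2 fr.
  by rewrite out_emit_idx // rv (ready_cols r2).
Qed.

Lemma out_emit b s : out (eval w (emit b) s) = out s ++ [:: b].
Proof. by rewrite eval_Do cats1. Qed.

Lemma out_emit_gcc s : ready s ->
  out (eval w emit_gcc s) = out s ++
    enc_seq enc_quad (nseq n (0, k, 0, 1) ++ nseq m (0, k, 1, k)).
Proof.
move=> r; rewrite /emit_gcc eval_Seq eval_Seq.
set choice := For vi vn _; set edges := For vi vm _.
set s1 := eval w _ s; have r1 : ready s1 by exact: ready_eval.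
set s2 := eval w _ s1; have r2 : ready s2 by exact: ready_eval.
have -> : out (eval w edges s2) = out s2 ++ flatten (mkseq (fun=> enc_quad (0, k, 1, k)) m).
  rewrite -(ready_m r2); apply: out_For => //; first exact: ready_bounded.
  move=> i s3 li b3 fr ri; have r3 := ready_frame (c := edges) isT r2 b3 fr.
  do 4 rewrite eval_Seq.
  set s4 := eval w _ s3; have r4 : ready s4 by exact: ready_eval.
  set s5 := eval w _ s4; have r5 : ready s5 by exact: ready_eval.
  set s6 := eval w _ s5; have r6 : ready s6 by exact: ready_eval.
  set s7 := eval w _ s6; have r7 : ready s7 by exact: ready_eval.
  rewrite out_emit_num // (ready_k r7) out_emit out_emit out_emit_num // (ready_k r4) out_emit.
  by rewrite /enc_quad -!catA.
have -> : out s2 = out s1 ++ flatten (mkseq (fun=> enc_quad (0, k, 0, 1)) n).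
  rewrite -(ready_n r1); apply: out_For => //; first exact: ready_bounded.
  move=> i s3 li b3 fr ri; have r3 := ready_frame (c := choice) isT r1 b3 fr.
  do 4 rewrite eval_Seq.
  set s4 := eval w _ s3; have r4 : ready s4 by exact: ready_eval.
  do 3 rewrite out_emit; rewrite out_emit_num // (ready_k r4) out_emit.
  by rewrite /enc_quad -!catA.
rewrite /s1 out_emit_num // (ready_cols r) -!catA; congr (_ ++ _).
rewrite /enc_seq size_cat !size_nseq map_cat flatten_cat !map_nseq.
have nseqE (T : Type) (a : T) j : mkseq (fun=> a) j = nseq j a.
  by elim: j => // j IH; rewrite -addn1 /mkseq iotaD map_cat -/(mkseq _ _) IH nseqD.
by rewrite !nseqE.
Qed.

(** The program emits the table by two nested loops, while the automaton lists it by a single index;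
    Euclidean division matches the two orders. *)
Lemma flatten_mkseq_divn (T : Type) (g : nat -> nat -> T) a b :
  mkseq (fun x => g (x %/ b.+1) (x %% b.+1)) (a * b.+1) =
  flatten (mkseq (fun j => mkseq (g j) b.+1) a).
Proof.
elim: a => // a IH; rewrite flatten_mkseqS -IH mulSn addnC /mkseq iotaD map_cat.
congr (_ ++ _); rewrite add0n -{1}(addn0 (a * _)) iotaDl -map_comp.
apply/eq_in_map => x; rewrite mem_iota /= => xb.
by rewrite divnMDl // modnMDl divn_small // modn_small // addn0.
Qed.

Lemma flatten_flatten (T : Type) (sss : seq (seq (seq T))) :
  flatten (flatten sss) = flatten (map flatten sss).
Proof. by elim: sss => //= ss sss IH; rewrite flatten_cat IH. Qed.

Lemma out_reduction : out (eval w reduction (init_state var)) = enc_rg instance.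
Proof.
rewrite /reduction; do 5 rewrite eval_Seq.
have [r1 o1] := parse_spec; move: (eval w parse _) r1 o1 => s1 r1 o1.
set s2 := eval w _ s1; have r2 : ready s2 by exact: ready_eval.
set s3 := eval w _ s2; have r3 : ready s3 by exact: ready_eval.
set s4 := eval w _ s3; have r4 : ready s4 by exact: ready_eval.
set s5 := eval w _ s4; have r5 : ready s5 by exact: ready_eval.
rewrite out_emit_gcc // out_emit_acc // out_emit_edges // out_emit_choice //.
rewrite out_emit_header // o1 /enc_rg /enc_dfa.
cbn [instance rg_R rg_dfa rg_gcc dfa_start dfa_trans dfa_acc].
rewrite /enc_seq !size_mkseq -!catA; do 4 congr (_ ++ _); rewrite catA; congr (_ ++ _).
rewrite (flatten_mkseq_divn moves) map_flatten flatten_flatten /mkseq -!map_comp.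
rewrite iotaD add0n map_cat flatten_cat.
rewrite (_ : iota n m = map (addn n) (iota 0 m)); last by rewrite -iotaDl addn0.
rewrite -map_comp; congr (_ ++ _).
  by congr flatten; apply: eq_map => j /=; rewrite -map_comp.
by congr flatten; apply: eq_map => j /=; rewrite -map_comp.
Qed.


(** * Correctness of the reduction *)

Let A := rg_dfa instance.
Let cols := n + m.

Lemma next_live j v b : j < cols -> v <= n ->
  dfa_next A (state_of j v) b = if b then on_true j v else state_of j.+1 v.
Proof.
move=> lj lv; have lt : state_of j v < cols * n.+1.
  have : j.+1 * n.+1 <= cols * n.+1 by rewrite leq_mul2r lj orbT.
  by rewrite /state_of mulSn; lia.
rewrite /dfa_next size_mkseq lt nth_mkseq // /moves /state_of.
by rewrite divnMDl // modnMDl divn_small // modn_small // addn0.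
Qed.

Lemma run_dead u : foldl (dfa_next A) dead u = dead.
Proof.
elim: u => //= b u IH; rewrite {2}/dfa_next size_mkseq ltnNge.
by rewrite /dead /state_of leq_addr.
Qed.

Lemma acc_state v : (state_of cols v \in dfa_acc A) = (v < n).
Proof.
apply/mapP/idP => [[x] | h]; last by exists v => //; rewrite mem_iota.
by rewrite mem_iota /= /state_of => h /eqP; rewrite eqn_add2l => /eqP ->.
Qed.

(** Induction along the row: [v] survives a true entry only in the column of an edge containing it;
    otherwise the run falls into [dead]. *)
Lemma run_chosen v j u : v < n -> j + size u = cols ->
  foldl (dfa_next A) (state_of j v) u \in dfa_acc A <->
  forall i, nth false u i -> n <= j + i /\ v \in nth [::] es (j + i - n).
Proof.
move=> vn; elim: u j => [|b u IH] j /= e.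
  by rewrite addn0 in e; rewrite e acc_state vn; split => // _ i; rewrite nth_nil.
rewrite next_live; [|lia|lia].
have {}IH := IH j.+1 ltac:(lia).
have shift :
    (forall i, nth false u i ->
       n <= j.+1 + i /\ v \in nth [::] es (j.+1 + i - n)) <->
    (forall i, nth false (b :: u) i.+1 ->
       n <= j + i.+1 /\ v \in nth [::] es (j + i.+1 - n)).
  by split => h i; have := h i; rewrite addSnnS.
case: b shift => shift; last first.
  rewrite IH; split; last by move=> h; apply/shift => i; apply: h.
  by move=> h [//|i]; move: i; apply/shift.
rewrite /on_true vn; case: ltnP => jn.
  rewrite run_dead -[dead]/(state_of cols n) acc_state ltnn; split => // h.
  by have [//|] := h 0; rewrite addn0; lia.
case: ifP => ve.
  rewrite IH; split; last by move=> h; apply/shift => i; apply: h.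
  move=> h [_|i]; last by move: i; apply/shift.
  by rewrite addn0.
rewrite run_dead -[dead]/(state_of cols n) acc_state ltnn; split => // h.
by have [//|] := h 0; rewrite addn0 ve.
Qed.

(** The first true entry makes the choice. Without one, [index true u] is [size u], so the sum is
    [cols], which is not below [n], and the row is rejected. *)
Lemma run_unchosen j u : j + size u = cols ->
  foldl (dfa_next A) (state_of j n) u \in dfa_acc A <->
  j + index true u < n /\ forall i, nth false u i ->
    i = index true u \/
    n <= j + i /\ j + index true u \in nth [::] es (j + i - n).
Proof.
elim: u j => [|b u IH] j /= e.
  rewrite addn0 in e; rewrite e acc_state ltnn; split => // [[]].
  by rewrite /cols; lia.
rewrite next_live; [|lia|lia].
have {}IH := IH j.+1 ltac:(lia).
case: b => /=.
  rewrite addn0 /on_true ltnn; case: (ltnP j n) => jn.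
    rewrite run_chosen //; last by lia.
    split => [h|[_ h] i ui]; last first.
      by have [//|] := h i.+1 ui; rewrite addSnnS.
    split => // [[|i]] ui; [by left | right].
    by have := h i ui; rewrite addSnnS.
  split; last by case; lia.
  (* The number [n] may occur in an edge, and then the run goes on; but past the vertex columns no
     choice can be made any more. *)
  case: ifP => _; first by rewrite IH => -[]; lia.
  by rewrite run_dead -[dead]/(state_of cols n) acc_state ltnn.
rewrite IH addSnnS; split => -[h1 h2]; split => //.
  move=> [//|i] /= ui; case: (h2 i ui) => [->|]; first by left.
  by rewrite addSnnS; right.
move=> i ui; case: (h2 i.+1 ui) => [[->]|]; first by left.
by rewrite addSnnS; right.
Qed.

(** The start state [n] is [state_of 0 n] by computation: column 0, nothing chosen. *)
Lemma accepts_row u : size u = cols ->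
  dfa_accepts A u <->
  index true u < n /\ forall i, nth false u i ->
    i = index true u \/ n <= i /\ index true u \in nth [::] es (i - n).
Proof. by move=> su; rewrite /dfa_accepts; apply: (@run_unchosen 0). Qed.

Lemma gcc_nth j : j < cols -> nth (0, 0, 0, 0) (rg_gcc instance) j =
  if j < n then (0, k, 0, 1) else (0, k, 1, k).
Proof.
rewrite /cols => lj; rewrite nth_cat size_nseq.
by case: ltnP => jn; rewrite nth_nseq ifT //; lia.
Qed.

Lemma rg_C_instance : rg_C instance = cols.
Proof. by rewrite /rg_C size_cat !size_nseq. Qed.

(** All edge columns open to [v] are set to true: this is the best choice, as they effectively have
    only a lower bound. *)
Definition row v :=
  mkseq (fun i => if i < n then i == v else v \in nth [::] es (i - n)) cols.

Lemma nth_row v i : i < cols ->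
  nth false (row v) i = if i < n then i == v else v \in nth [::] es (i - n).
Proof. by move=> li; rewrite nth_mkseq. Qed.

Lemma index_row v : v < n -> index true (row v) = v.
Proof.
move=> vn; have vc : v < cols by rewrite /cols; lia.
have sr : size (row v) = cols by rewrite size_mkseq.
rewrite -[row v](cat_take_drop v) index_cat ifN; last first.
  apply/(nthP false) => -[i]; rewrite size_take sr vc => iv.
  rewrite nth_take // nth_row; last by lia.
  by rewrite (ltn_trans iv vn) => /eqP; lia.
rewrite size_take sr vc (drop_nth false) ?sr // nth_row // vn eqxx /=.
by rewrite addn0.
Qed.

Lemma count_column b i (X : seq (seq bool)) :
  count_mem b (map (fun r => nth false r i) X) = count (fun r => nth false r i == b) X.
Proof. by rewrite count_map. Qed.

Lemma instance_correct : hs_yes I <-> rg_yes instance.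
Proof.
split.
  case=> S [uS sS aS hS]; exists (map row S); split.
  - by rewrite size_map.
  - by apply/allP => _ /mapP[v _ ->]; rewrite size_mkseq rg_C_instance.
  - apply/allP => _ /mapP[v vS ->]; have vn : v < n := allP aS v vS.
    apply/accepts_row; first by rewrite size_mkseq.
    rewrite index_row //; split => // i.
    case: (ltnP i cols) => ic; last by rewrite nth_default // size_mkseq.
    rewrite nth_row //; case: ltnP => [_ /eqP|]; by [left | right].
  move=> j; rewrite rg_C_instance => jc; rewrite gcc_nth // -map_comp.
  have ck a : count a (map ((fun r => nth false r j) \o row) S) <= k.
    by rewrite /k -sS -(size_map ((fun r => nth false r j) \o row)) count_size.
  case: ltnP => jn; split; rewrite ?ck //=.
  - rewrite count_map; apply: leq_trans (_ : count_mem j S <= 1); last first.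
      by rewrite count_uniq_mem // leq_b1.
    by apply: sub_count => v /=; rewrite nth_row // jn eqb_id eq_sym.
  - rewrite ?andbT -has_count has_map.
    have em : nth [::] es (j - n) \in es.
      by apply: mem_nth; rewrite -/m; rewrite /cols in jc; lia.
    have /hasP[v ve vS] := allP hS _ em.
    by apply/hasP; exists v => //=; rewrite nth_row // ltnNge jn ve.
case=> X [sX szX accX colX]; rewrite rg_C_instance in szX colX.
have rowP r : r \in X -> index true r < n /\ forall i, nth false r i ->
    i = index true r \/ n <= i /\ index true r \in nth [::] es (i - n).
  by move=> rX; apply/accepts_row; [apply/eqP; apply: (allP szX) | apply: (allP accX)].
exists (map (index true) X); split.
(* Distinctness: the rows choosing [v] all have a true entry in column [v], where at most one is
   allowed. *)
- apply/count_mem_uniq => v; case: (boolP (v \in _)) => vX; last first.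
    exact: count_memPn.
  apply/eqP; rewrite eqn_leq -has_count has_pred1 vX andbT.
  have vn : v < n by case/mapP: vX => r /rowP[] h _ ->.
  have := colX v; rewrite gcc_nth /cols ?vn; last by lia.
  case; [lia | move=> _ /=]; rewrite count_column => h.
  apply: leq_trans h; rewrite count_map.
  rewrite (@eq_in_count _ _ (fun r => nth false r v && (index true r == v))).
    by apply: sub_count => r /= /andP[->].
  move=> r rX /=; case: eqP => [<-|_]; last by rewrite andbF.
  have [lr _] := rowP _ rX; rewrite nth_index // -index_mem.
  by rewrite (eqP (allP szX _ rX)) /cols; lia.
- by rewrite size_map.
- by apply/allP => _ /mapP[r rX ->]; have [] := rowP _ rX.
(* Some row has a true entry in the column of the edge. That entry is not the row's choice, which
   lies in a vertex column, so the chosen vertex belongs to the edge. *)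
apply/allP => e /(nthP [::])[i im <-].
have jc : n + i < cols by rewrite /cols ltn_add2l.
have := colX _ jc; rewrite gcc_nth // ltnNge leq_addr /= => -[_ /andP[]].
rewrite -has_count has_map => /hasP[r rX /= /eqP tr] _.
have [lr] := rowP _ rX => /(_ (n + i)); rewrite tr => /(_ isT) [|[_]].
  by lia.
rewrite addKn => re; apply/hasP; exists (index true r) => //.
exact: map_f.
Qed.

End Reduction.

(** * Computability of the two bounding functions *)

Definition id_machine : TM := {|
  tm_st := unit; tm_gam := option bool; tm_blank := None;
  tm_in := Some; tm_out := id; tm_start := tt; tm_halt := tt;
  tm_delta := fun q a => (q, a, DStay) |}.

Lemma computable_id : fn_computable id.
Proof.
exists id_machine => n; exists 0; exists 0 => //; split => //=.
by elim: (enc_nat n) => //= b s ->.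
Qed.

(* Input symbols are read as [None], so they cannot extend the output [1; 0]. *)
Definition one_machine : TM := {|
  tm_st := option bool; tm_gam := option bool; tm_blank := None;
  tm_in := fun=> None; tm_out := id; tm_start := Some true; tm_halt := None;
  tm_delta := fun q _ =>
    match q with
    | Some true => (Some false, Some true, DRight)
    | Some false => (None, Some false, DLeft)
    | None => (None, None, DStay)
    end |}.

Lemma computable_one : fn_computable (fun=> 1).
Proof.
exists one_machine => n; exists 2; exists 2 => //=.
by case: n => [|[|[|n]]].
Qed.

Theorem theorem7 : W2_hard rg_yes rg_R enc_rg.
Proof.
have [e run] := @compiled_runs_poly _ reduction isT.
(* The running time is polynomial in the input alone, so the factor depending on the parameter is 1;
   the number of rows is [hs_k] itself, hence [id]. *)
exists (compiled reduction), (fun=> 1), id, e.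
split; first exact: computable_one.
split; first exact: computable_id.
move=> I; exists (instance I); split; last by split; first exact: instance_correct.
by rewrite mul1n -out_reduction; apply: run; apply: leq_ltn_trans (size_edges I).
Qed.
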